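(* Let $d\ge 1$, $\varkappa>0$, and let $a:\mathbb Z^d\to\mathbb R$ satisfy $a(z)\ge 0$ and $a(z)=a(-z)$ for $z\ne 0$, $\sum_{z\ne 0}a(z)=1$, $a(0)=-1$, with the set $\{z: a(z)>0\}$ spanning $\mathbb Z^d$. Let $b_n(x)\ge 0$ ($n\ge 2$), $\mu(x)\ge 0$ and $k(x)$ be bounded functions of $x\in\mathbb Z^d$, put $\beta(x)=\sum_{n\ge 2}(n-1)b_n(x)$, and suppose that there are constants $\delta_1,\delta_2>0$ such that $\mu(x)-\beta(x)\ge\delta_1$ and $k(x)\ge\delta_2$ for all $x\in\mathbb Z^d$. Let $m_1(t,x)$, $t\ge 0$, $x\in\mathbb Z^d$, be the solution, bounded on $[0,T]\times\mathbb Z^d$ for every $T>0$, of the Cauchy problem $$\frac{\partial m_1(t,x)}{\partial t}=\varkappa\sum_{z\ne 0}a(z)\bigl(m_1(t,x+z)-m_1(t,x)\bigr)+\bigl(\beta(x)-\mu(x)\bigr)m_1(t,x)+k(x),\qquad m_1(0,x)=u_0(x),$$ where the initial condition $u_0:\mathbb Z^d\to\mathbb R$ is bounded. Then for every $x\in\mathbb Z^d$ the limit $$m_1(\infty,x)=\lim_{t\to\infty}m_1(t,x)$$ exists (as a finite number).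
   Context: The function $m_1(t,x)=\mathsf E\,n(t,x)$ is the first moment of the particle field $n(t,x)$ (number of particles at time $t$ at site $x$) of a continuous-time branching random walk with immigration on $\mathbb Z^d$: particles jump from $x$ to $x+z$ at rate $\varkappa a(z)$, die at rate $\mu(x)$, turn into $n\ge2$ particles at rate $b_n(x)$, and new particles immigrate at site $x$ at rate $k(x)$. In this model $m_1$ satisfies the Cauchy problem displayed in the claim, with $u_0(x)=\mathsf E\,n(0,x)$. A solution means a function differentiable in $t$ for each $x$ satisfying the equation for all $t\ge 0$. *)

(* Defs.v *)
From mathcomp Require Import all_boot all_order all_algebra.
From mathcomp Require Import all_classical all_reals all_analysis.

Set Implicit Arguments.
Unset Strict Implicit.
Unset Printing Implicit Defensive.

Import Order.TTheory GRing.Theory Num.Theory.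
Import numFieldNormedType.Exports.

Local Open Scope classical_set_scope.
Local Open Scope ring_scope.

(* The lattice Z^d is the type 'rV[int]_d. *)

Definition spans_lattice (d : nat) (A : set 'rV[int]_d) : Prop :=
  forall x : 'rV[int]_d,
    exists (s : seq 'rV[int]_d) (c : 'rV[int]_d -> int),
      (forall z, z \in s -> A z) /\ x = \sum_(z <- s) c z *: z.

(* Sum of the positive parts minus sum of the negative parts over D; the usual
   sum when f is summable over D (otherwise a junk value, [fine +oo] being 0). *)
Definition rsum (R : realType) (T : choiceType) (D : set T) (f : T -> R) : R :=
  fine (\esum_(z in D) (EFin \o f)^\+ z)%E
  - fine (\esum_(z in D) (EFin \o f)^\- z)%E.

(* f'(t) = l for f considered on [0, +oo[ only: the difference quotient uses
   no value of f at a negative time, so that the derivative is two-sided for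
   t > 0 and right-sided for t = 0. *)
Definition is_derive_ge0 (R : realType) (f : R -> R) (t l : R) : Prop :=
  h^-1 * (f (t + h) - f t) @[h --> within [set h : R | 0 <= t + h] 0^'] --> l.

Definition beta_partial (R : realType) (d : nat)
    (b : nat -> 'rV[int]_d -> R) (x : 'rV[int]_d) (N : nat) : R :=
  \sum_(2 <= n < N) (n%:R - 1) * b n x.

Definition beta (R : realType) (d : nat)
    (b : nat -> 'rV[int]_d -> R) (x : 'rV[int]_d) : R :=
  limn (beta_partial b x).

(* Main.v *)
(* For fixed [h] in [0, 1] the difference [w(t) = m1(t + h) - m1(t)] solves the
   equation without the source term [k], and the killing rate [mu - beta] is at
   least [delta1].  A maximum principle for bounded solutions on the infinite
   lattice then gives [|w(t, x)| <= e^(-delta1 t) sup |w(0, .)|].  The supremum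
   is bounded uniformly in [h], so chaining the increments over unit steps shows
   that [t |-> m1(t, x)] is Cauchy at infinity. *)

Require Import Defs.
From mathcomp Require Import all_boot all_order all_algebra.
From mathcomp Require Import all_classical all_reals all_analysis.
From mathcomp Require Import ring lra.

Import Order.TTheory GRing.Theory Num.Theory.
Import numFieldNormedType.Exports.

Local Open Scope classical_set_scope.
Local Open Scope ring_scope.

(** * Jump sums as nonnegative series *)

Lemma ge0_esumZl (R : realType) (T : choiceType) (D : set T) (a : T -> \bar R)
    (r : R) : 0 <= r -> (forall i, 0 <= a i)%E ->
  (\esum_(i in D) (r%:E * a i) = r%:E * \esum_(i in D) a i)%E.
Proof.
move=> r0 a0; rewrite /esum -ereal_supZl //; last first.
  by apply/set0P; eexists; exists set0; last reflexivity; exact: fsets_set0.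
rewrite image_comp; congr ereal_sup; apply: eq_imagel => A _ /=.
by rewrite ge0_mule_fsumr.
Qed.

(** Adding [C] makes all values nonnegative, and as [a] has total mass 1 the correction is the
    constant [p + C]. The signed sum thus becomes a nonnegative series, which can be compared
    termwise. *)
Lemma rsum_jump (R : realType) (T : choiceType) (D : set T) (a f : T -> R)
    (p C : R) :
  (forall z, D z -> 0 <= a z) -> (\esum_(z in D) (a z)%:E = 1)%E ->
  (forall z, D z -> `|f z| <= C) -> `|p| <= C ->
  ((rsum D (fun z => a z * (f z - p)))%:E =
   \esum_(z in D) (a z * (f z + C))%:E - (p + C)%:E)%E.
Proof.
move=> a0 a1 fC pC.
have esuma r : 0 <= r -> (\esum_(z in D) (r * a z)%:E = r%:E)%E.
  (* [a] is nonnegative only on [D], while [ge0_esumZl] wants this everywhere; hence the absolute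
     value. *)
  move=> r0; transitivity (\esum_(z in D) (r%:E * `|a z|%:E))%E.
    by apply: eq_esum => z Dz; rewrite ger0_norm ?a0// EFinM.
  rewrite ge0_esumZl// -[RHS]mule1 -a1; congr (_ * _)%E.
  by apply: eq_esum => z Dz; rewrite ger0_norm ?a0.
have C0 : 0 <= C by apply: le_trans pC.
have pC0 : 0 <= p + C by move: pC; rewrite ler_norml; lra.
have fC0 z : D z -> 0 <= f z + C by move=> /fC; rewrite ler_norml; lra.
have sumf : (\esum_(z in D) (a z * (f z + C))%:E <= (C + C)%:E)%E.
  rewrite -esuma ?addr_ge0//; apply: le_esum => z Dz; rewrite lee_fin mulrC.
  by rewrite ler_wpM2r ?a0// lerD2r (le_trans (ler_norm _))// fC.
have sumf0 : (0 <= \esum_(z in D) (a z * (f z + C))%:E)%E.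
  by apply: esum_ge0 => z Dz; rewrite lee_fin mulr_ge0 ?a0 ?fC0.
have := @esumB R T D (fun z => (a z * (f z + C))%:E)
  (fun z => ((p + C) * a z)%:E).
rewrite esuma// => H.
pose F := fun z => a z * (f z - p).
have FE : EFin \o F =
    ((fun z => (a z * (f z + C))%:E) \- (fun z => ((p + C) * a z)%:E))%E.
  by apply/funext => z /=; rewrite -EFinB /F; congr EFin; ring.
rewrite -FE in H.
have abs_sum (g : T -> R) : (forall z, D z -> 0 <= g z) ->
    (\esum_(z in D) `|(g z)%:E| = \esum_(z in D) (g z)%:E)%E.
  by move=> g0; apply: eq_esum => z Dz; rewrite gee0_abs// lee_fin g0.
have sf : summable D (fun z => (a z * (f z + C))%:E).
  rewrite /summable abs_sum; first by apply: le_lt_trans sumf _; rewrite ltry.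
  by move=> z Dz; rewrite mulr_ge0 ?a0 ?fC0.
have sp : summable D (fun z => ((p + C) * a z)%:E).
  rewrite /summable abs_sum ?esuma ?ltry//.
  by move=> z Dz; rewrite mulr_ge0 ?a0.
have {}H : (\esum_(z in D) (EFin \o F)^\+ z - \esum_(z in D) (EFin \o F)^\- z
    = \esum_(z in D) (a z * (f z + C))%:E - (p + C)%:E)%E.
  by apply: H => // z Dz; rewrite lee_fin mulr_ge0 ?a0 ?fC0.
have sF : summable D (EFin \o F) by rewrite FE; exact: summableB.
(* Both parts are finite, so [fine] does not fall back on its default value 0. *)
have finp : (\esum_(z in D) (EFin \o F)^\+ z)%E \is a fin_num.
  have := summable_funepos sF; rewrite summableE.
  by under eq_esum do rewrite gee0_abs//.
have finn : (\esum_(z in D) (EFin \o F)^\- z)%E \is a fin_num.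
  have := summable_funeneg sF; rewrite summableE.
  by under eq_esum do rewrite gee0_abs//.
by rewrite /rsum -/F EFinB !fineK// H.
Qed.

(** The jump estimate behind the maximum principle: the weights average [f - g], and total mass 1
    leaves [p - q] unchanged. *)
Lemma rsum_jumpB_le (R : realType) (T : choiceType) (D : set T)
    (a f g : T -> R) (p q C beta : R) :
  (forall z, D z -> 0 <= a z) -> (\esum_(z in D) (a z)%:E = 1)%E ->
  (forall z, D z -> `|f z| <= C) -> (forall z, D z -> `|g z| <= C) ->
  `|p| <= C -> `|q| <= C -> 0 <= beta ->
  (forall z, D z -> f z - g z <= beta) ->
  rsum D (fun z => a z * (f z - p)) - rsum D (fun z => a z * (g z - q)) <=
  beta - (p - q).
Proof.
move=> a0 a1 fC gC pC qC beta0 fg.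
have le_C (r : R) : `|r| <= C -> `|r| <= C + beta by move=> /le_trans; apply; lra.
(* Shifting [g] by [beta] reduces the claim to monotonicity of the sum. *)
have shift_C r : `|r| <= C -> `|r + beta| <= C + beta.
  by move=> rC; rewrite (le_trans (ler_normD _ _))// (ger0_norm beta0) lerD2r.
have -> : rsum D (fun z => a z * (g z - q)) =
    rsum D (fun z => a z * (g z + beta - (q + beta))).
  by congr rsum; apply/funext => z; congr (_ * _); ring.
have addK (r u : R) (e : \bar R) : r%:E = (e - u%:E)%E -> (r + u)%:E = e.
  by rewrite EFinD => ->; rewrite subeK.
(* [C + beta] bounds both [f] and the shifted [g], so both series use the same translation. *)
have /addK Ef := @rsum_jump _ _ _ _ _ _ _ a0 a1
  (fun z Dz => le_C _ (fC z Dz)) (le_C _ pC).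
have /addK Eg := @rsum_jump _ _ _ _ _ _ _ a0 a1
  (fun z Dz => shift_C _ (gC z Dz)) (shift_C _ qC).
set Sf := rsum _ _ in Ef *; set Sg := rsum _ _ in Eg *.
suff : ((Sf + (p + (C + beta)))%:E <= (Sg + (q + beta + (C + beta)))%:E)%E.
  by rewrite lee_fin; lra.
rewrite Eg Ef; apply: le_esum => z Dz; rewrite lee_fin ler_wpM2l ?a0//.
by have := fg z Dz; lra.
Qed.

(** * Differential inequalities and the maximum principle *)

Lemma is_derive_expRMl (R : realType) (c s : R) :
  is_derive s (1 : R) (fun s : R => expR (c * s)) (expR (c * s) * c).
Proof. by apply: is_derive_eq; rewrite scaler1. Qed.

(** Integrating factor: [e^(c s) y(s)] is nonincreasing. *)
Lemma comparison_ode (R : realType) (y dy : R -> R) (c T : R) :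
  {within `[0, T], continuous y} ->
  (forall t : R, t \in `]0, T[%R -> is_derive t (1 : R) y (dy t)) ->
  (forall t : R, t \in `]0, T[%R -> dy t <= - c * y t) ->
  y 0 <= 0 -> forall t : R, t \in `[0, T]%R -> y t <= 0.
Proof.
move=> cy Dy dyle y0 t tT.
have /andP[t0 tleT] : 0 <= t <= T by rewrite in_itv/= in tT.
have ce : continuous (fun s : R => expR (c * s)).
  by move=> s; apply: continuous_comp; [exact: mulrl_continuous|
    exact: continuous_expR].
have Dg s : s \in `]0, T[%R -> is_derive s (1 : R)
    ((fun s => expR (c * s)) * y)
    (expR (c * s) * dy s + y s * (expR (c * s) * c)).
  move=> sT; have Ds := Dy s sT; have De := is_derive_expRMl R c s.
  by apply: is_derive_eq.
have : expR (c * t) * y t <= expR (c * 0) * y 0.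
  apply: (@ler0_derive1_le_cc _ ((fun s => expR (c * s)) * y) 0 T) => //.
  - by move=> s /Dg[].
  - move=> s sT; have Ds := Dg s sT; rewrite derive1E derive_val.
    have -> : expR (c * s) * dy s + y s * (expR (c * s) * c) =
              expR (c * s) * (dy s + c * y s) by ring.
    by rewrite pmulr_rle0 ?expR_gt0//; have := dyle s sT; lra.
  - move=> s; apply: cvgM; last exact: cy.
    by apply: continuous_subspaceT.
  - by rewrite in_itv/= lexx (le_trans t0).
rewrite mulr0 expR0 mul1r => /le_trans /(_ y0).
by rewrite pmulr_rle0 ?expR_gt0.
Qed.

(* The barrier solves [g' = kappa * (B e^(-delta s) - g) - delta g]. *)
Lemma barrier_bound (R : realType) (X : Type) (w J : R -> X -> R) (V : X -> R)
    (kappa delta A B T : R) :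
  0 <= delta -> 0 <= A -> A <= B -> 0 < kappa ->
  (forall x, delta <= V x) ->
  (forall x, {within `[0, T], continuous (w^~ x)}) ->
  (forall t x, t \in `]0, T[%R ->
    is_derive t (1 : R) (w^~ x) (J t x - (kappa + V x) * w t x)) ->
  (forall t x, t \in `]0, T[%R -> J t x <= kappa * (B * expR (- delta * t))) ->
  (forall x, w 0 x <= A) ->
  forall t x, t \in `[0, T]%R ->
    w t x <= expR (- delta * t) * (B - (B - A) * expR (- kappa * t)).
Proof.
move=> delta0 A0 AB kappa0 dV cw Dw Jle wA t x tT.
pose g (s : R) := expR (- delta * s) * (B - (B - A) * expR (- kappa * s)).
pose dg (s : R) := kappa * (B * expR (- delta * s) - g s) - delta * g s.
have Dg s : is_derive s (1 : R) g (dg s).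
  have D1 := is_derive_expRMl R (- delta) s.
  have D2 := is_derive_expRMl R (- kappa) s.
  by apply: is_derive_eq; rewrite /dg /g /GRing.scale/=; ring.
have g0 s : 0 <= s -> 0 <= g s.
  move=> s0; rewrite /g mulr_ge0 ?expR_ge0// subr_ge0.
  have : expR (- kappa * s) <= 1.
    by rewrite -expR0 ler_expR mulNr oppr_le0 mulr_ge0// ltW.
  have := expR_ge0 (- kappa * s); nra.
rewrite -subr_le0 -/(g t).
(* With [y = w - g], the quantity [y' + (kappa + V) y] equals [(J - kappa B e^(-delta s)) - (V -
   delta) g], which is at most 0 because [g] is nonnegative. *)
apply: (@comparison_ode R (fun s => w s x - g s)
  (fun s => J s x - (kappa + V x) * w s x - dg s) (kappa + V x) T) => //.
- move=> s; apply: cvgB; first exact: cw.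
  apply: continuous_subspaceT => r.
  by apply/differentiable_continuous/derivable1_diffP; case: (Dg r).
- move=> s sT; have Ds := Dw s x sT; have Dgs := Dg s.
  exact: is_deriveB.
- move=> s sT; have := Jle s x sT; rewrite /dg.
  have s0 : 0 <= s by move: sT; rewrite in_itv/= => /andP[/ltW].
  have := mulr_ge0 (g0 s s0) (_ : 0 <= V x - delta).
  by rewrite subr_ge0 => /(_ (dV x)); lra.
- by rewrite /g !mulr0 expR0 mul1r mulr1; have := wA x; lra.
Qed.

(* The lattice is infinite, so suprema need not be attained; instead, with [B]
   the supremum of [e^(delta t) w], the barrier would give
   [B <= B - (B - A) e^(-kappa T)], which forces [B <= A]. *)
Lemma maximum_principle (R : realType) (X : Type) (w J : R -> X -> R)
    (V : X -> R) (kappa delta A C T : R) :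
  0 <= delta -> 0 <= A -> 0 < kappa -> 0 < T ->
  (forall x, delta <= V x) ->
  (forall t x, t \in `[0, T]%R -> w t x <= C) ->
  (forall x, {within `[0, T], continuous (w^~ x)}) ->
  (forall t x, t \in `]0, T[%R ->
    is_derive t (1 : R) (w^~ x) (J t x - (kappa + V x) * w t x)) ->
  (forall t x beta, t \in `]0, T[%R -> 0 <= beta ->
    (forall y, w t y <= beta) -> J t x <= kappa * beta) ->
  (forall x, w 0 x <= A) ->
  forall t x, t \in `[0, T]%R -> w t x <= A * expR (- delta * t).
Proof.
move=> delta0 A0 kappa0 T0 dV wC cw Dw Jle wA t x tT.
have expK s : expR (delta * s) * expR (- delta * s) = 1.
  by rewrite -expRD mulNr subrr expR0.
pose S := [set r : R | exists s y, s \in `[0, T]%R /\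
  r = expR (delta * s) * w s y].
have S0 : S !=set0.
  by exists (expR (delta * t) * w t x); exists t, x.
have Sub : has_ubound S.
  (* [C] may be negative, and then enlarging the exponential would lower the product; hence
     [|C|]. *)
  exists (expR (delta * T) * `|C|) => _ [s [y [sT ->]]].
  have /andP[s0 sleT] : 0 <= s <= T by rewrite in_itv/= in sT.
  apply: (@le_trans _ _ (expR (delta * s) * `|C|)).
    by rewrite ler_wpM2l ?expR_ge0// (le_trans (wC s y sT))// ler_norm.
  by rewrite ler_wpM2r// ler_expR ler_wpM2l.
set B := sup S.
have wB s y : s \in `[0, T]%R -> w s y <= B * expR (- delta * s).
  move=> sT; have : expR (delta * s) * w s y <= B.
    by apply: ub_le_sup => //; exists s, y.
  by rewrite -(ler_pM2r (expR_gt0 (- delta * s))) mulrAC expK mul1r.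
suff BA : B <= A.
  by rewrite (le_trans (wB _ _ tT))// ler_wpM2r ?expR_ge0.
rewrite leNgt; apply/negP => AB.
(* Since [e^(-kappa s)] is at least [e^(-kappa T)] on [[0, T]], the barrier gives a single upper
   bound for all of [S]. *)
have : B <= B - (B - A) * expR (- kappa * T).
  apply: sup_le_ub => // _ [s [y [sT ->]]].
  have /andP[s0 sleT] : 0 <= s <= T by rewrite in_itv/= in sT.
  have := @barrier_bound R X w J V kappa delta A B T delta0 A0 (ltW AB) kappa0
    dV cw Dw _ wA s y sT.
  move=> /(_ _)/wrap[].
    move=> r z rT; apply: Jle => //.
      by rewrite mulr_ge0 ?expR_ge0// (le_trans A0)// ltW.
    by move=> u; apply: wB; apply: subset_itv_oo_cc.
  rewrite -(ler_pM2l (expR_gt0 (delta * s))) mulrA expK mul1r => /le_trans.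
  apply; rewrite lerD2l lerN2 ler_wpM2l ?subr_ge0 ?(ltW AB)// ler_expR.
  by rewrite !mulNr lerN2 ler_wpM2l// ltW.
apply/negP; rewrite -ltNge gtrBl mulr_gt0 ?expR_gt0 ?subr_gt0//.
Qed.

(** * Calculus from derivatives restricted to nonnegative times *)

Lemma is_derive_ge0_gt0 (R : realType) (f : R -> R) (t l : R) : 0 < t ->
  is_derive_ge0 f t l -> is_derive t (1 : R) f l.
Proof.
move=> t0 fl.
have {}fl : h^-1 *: (f (h *: (1 : R) + t) - f t) @[h --> 0^'] --> l.
  (* For [t > 0] the constraint [0 <= t + h] holds for all small [h], so the restricted filter loses
     nothing. *)
  have pos : \forall h \near (0 : R)^', 0 <= t + h.
    near=> h; have : `|h| <= t by near: h; apply: dnbhs0_le.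
    by rewrite ler_norml; lra.
  apply: cvg_trans fl => A /= fA.
  have {}fA : \forall h \near (0 : R)^', 0 <= t + h ->
    A (h^-1 * (f (t + h) - f t)) by exact: fA.
  change (\forall h \near (0 : R)^', A (h^-1 * (f (h * 1 + t) - f t))).
  near=> h; rewrite mulr1 (addrC h); apply: (near fA h) => //; near: h.
  exact: pos.
apply: DeriveDef; last exact: cvg_lim fl.
by apply/cvg_ex; exists l.
Unshelve. all: by end_near.
Qed.

Lemma is_derive_ge0_cvg_right (R : realType) (f : R -> R) (l : R) :
  is_derive_ge0 f 0 l -> f @ 0^'+ --> f 0.
Proof.
move=> fl.
have {}fl : h^-1 * (f h - f 0) @[h --> 0^'+] --> l.
  apply: cvg_trans fl => A /= fA; rewrite /at_right.
  have {}fA : \forall h \near (0 : R), h != 0 -> 0 <= 0 + h ->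
    A (h^-1 * (f (0 + h) - f 0)) by exact: fA.
  change (\forall h \near (0 : R), 0 < h -> A (h^-1 * (f h - f 0))).
  near=> h => h0; have := near fA h; rewrite add0r.
  by apply; rewrite ?gt_eqF// ltW.
(* Multiplying the convergent quotient by [h] recovers [f h], whose limit is then [f 0]. *)
have : h * (h^-1 * (f h - f 0)) + f 0 @[h --> 0^'+] --> 0 * l + f 0.
  apply: cvgD; last exact: cvg_cst.
  apply: cvgM fl.
  by apply: cvg_at_right_filter; exact: cvg_id.
rewrite mul0r add0r; apply: cvg_trans; apply: near_eq_cvg.
near=> h.
have h0 : 0 < h by near: h; exact: nbhs_right_gt.
by rewrite mulVKf ?subrK// gt_eqF.
Unshelve. all: by end_near.
Qed.

Lemma is_derive_ge0_within_continuous (R : realType) (f df : R -> R) (T : R) :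
  0 < T -> (forall t, 0 <= t -> is_derive_ge0 f t (df t)) ->
  {within `[0, T], continuous f}.
Proof.
move=> T0 Df.
have cf t : 0 < t -> {for t, continuous f}.
  move=> t0; apply/differentiable_continuous/derivable1_diffP.
  by have [] := is_derive_ge0_gt0 R f t _ t0 (Df t (ltW t0)).
apply/continuous_within_itvP => //; split.
- by move=> t; rewrite in_itv/= => /andP[t0 _]; exact: cf.
- exact: is_derive_ge0_cvg_right (Df 0 (lexx 0)).
- by apply: cvg_at_left_filter; exact: cf.
Qed.

Lemma is_derive_shiftr (R : realType) (f : R -> R) (t h l : R) :
  is_derive (t + h) (1 : R) f l -> is_derive t (1 : R) (fun s => f (s + h)) l.
Proof.
move=> Df.
have Ds : is_derive t (1 : R) (fun s : R => s + h) 1.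
  by apply: is_derive_eq; rewrite addr0.
have := @is_derive1_comp R f (fun s => s + h) t l 1 Df Ds.
by rewrite mulr1.
Qed.

(** * Convergence from exponentially decaying increments *)

(* Chaining the increments over unit steps gives a geometric series. *)
Lemma exp_increments_cvg (R : realType) (f : R -> R) (K delta : R) :
  0 < delta ->
  (forall t h, 0 <= t -> 0 <= h <= 1 ->
    `|f (t + h) - f t| <= K * expR (- delta * t)) ->
  exists l : R, f t @[t --> +oo] --> l.
Proof.
move=> delta0 fK.
set q := expR (- delta).
have q1 : q < 1 by rewrite -expR0 ltr_expR oppr_lt0.
have K0 : 0 <= K.
  have := fK 0 0 (lexx 0); rewrite lexx ler01 => /(_ isT).
  by rewrite mulr0 expR0 mulr1; apply: le_trans.
(* The sum of the series [K q^n]; the identity [K' = K + K' q] closes the induction below, with a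
   bound independent of [n]. *)
set K' := K / (1 - q).
have K'E : K' = K + K' * q by rewrite /K'; field; rewrite subr_eq0 gt_eqF.
have K'0 : 0 <= K' by rewrite divr_ge0// subr_ge0 ltW.
have chain (n : nat) t s : 0 <= t -> 0 <= s <= n%:R ->
    `|f (t + s) - f t| <= K' * expR (- delta * t).
  elim: n t s => [|n IH] t s t0 /andP[s0 sn].
    have -> : s = 0 by apply/eqP; rewrite eq_le sn s0.
    by rewrite addr0 subrr normr0 mulr_ge0 ?expR_ge0.
  have [s1|/ltW s1] := leP s 1.
    rewrite (le_trans (fK _ _ t0 _)) ?s0// ler_wpM2r ?expR_ge0// K'E lerDl.
    by rewrite mulr_ge0 ?expR_ge0.
  (* The first unit step costs [K e^(-delta t)]; the rest starts at [t + 1] and costs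
     [K' q e^(-delta t)]. *)
  have step := fK t 1 t0; rewrite ler01 lexx in step; have {}step := step isT.
  have := IH (t + 1) (s - 1); rewrite subr_ge0 s1 lerBlDr natr1 sn addr_ge0//.
  move=> /(_ isT isT); rewrite (_ : t + 1 + (s - 1) = t + s); last by ring.
  rewrite mulrDr mulr1 expRD -/q => rest.
  rewrite -(subrK (f (t + 1)) (f (t + s))) -addrA (le_trans (ler_normD _ _))//.
  by rewrite K'E mulrDl; lra.
apply/cvg_ex/cauchy_cvgP/cauchy_exP => e e0.
have [t0 [t00 t0e]] : exists t0, 0 <= t0 /\ K' * expR (- delta * t0) < e.
  (* Chosen so that [delta t0 = K' / e], whence [e^(delta t0) >= 1 + K' / e > K' / e]. *)
  exists (K' / (e * delta)); split; first by rewrite divr_ge0// mulr_ge0// ltW.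
  set u := delta * (K' / (e * delta)).
  have uE : e * u = K' by rewrite /u; field; rewrite !gt_eqF.
  have eu : 1 + u <= expR u by exact: expR_ge1Dx.
  rewrite mulNr -/u expRN ltr_pdivrMr ?expR_gt0// -uE ltr_pM2l//.
  by apply: lt_le_trans eu; rewrite ltrDr.
exists (f t0).
change (\forall t \near +oo, ball (f t0) e (f t)).
near=> t; have tt0 : t0 <= t.
  by near: t; exact: (nbhs_pinfty_ge (num_real _)).
rewrite -ball_normE /ball_/= distrC; apply: le_lt_trans t0e.
have -> : t = t0 + (t - t0) by ring.
have [n tn] : exists n : nat, t - t0 <= n%:R.
  by exists (Num.truncn (t - t0)).+1; rewrite ltW// truncnS_gt.
by apply: (chain n) => //; rewrite subr_ge0 tt0.
Unshelve. all: by end_near.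
Qed.

(** * Comparison of two solutions and the limit *)

(** The source [k] cancels in [m - m']. Adding [w] to the difference of jump terms in [J] separates
    the loss rate [kappa] and gives the form required by [maximum_principle]. *)
Lemma solution_comparison (R : realType) (X : zmodType) (D : set X)
    (a V k : X -> R) (kappa delta A C T : R) (m m' : R -> X -> R) :
  (forall z, D z -> 0 <= a z) -> (\esum_(z in D) (a z)%:E = 1)%E ->
  0 <= delta -> 0 <= A -> 0 < kappa -> 0 < T ->
  (forall x, delta <= V x) ->
  let rhs (u : X -> R) x :=
    kappa * rsum D (fun z => a z * (u (x + z) - u x)) - V x * u x + k x in
  (forall t x, t \in `[0, T]%R -> `|m t x| <= C) ->
  (forall t x, t \in `[0, T]%R -> `|m' t x| <= C) ->
  (forall x, {within `[0, T], continuous (m^~ x)}) ->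
  (forall x, {within `[0, T], continuous (m'^~ x)}) ->
  (forall t x, t \in `]0, T[%R -> is_derive t (1 : R) (m^~ x) (rhs (m t) x)) ->
  (forall t x, t \in `]0, T[%R -> is_derive t (1 : R) (m'^~ x) (rhs (m' t) x)) ->
  (forall x, m 0 x - m' 0 x <= A) ->
  forall t x, t \in `[0, T]%R -> m t x - m' t x <= A * expR (- delta * t).
Proof.
move=> a0 a1 delta0 A0 kappa0 T0 dV rhs mC mC' cm cm' Dm Dm' mA.
pose jump (u : X -> R) x := rsum D (fun z => a z * (u (x + z) - u x)).
pose w t x := m t x - m' t x.
pose J t x := kappa * (jump (m t) x - jump (m' t) x + w t x).
apply: (@maximum_principle R X w J V kappa delta A (C + C) T) => //.
- move=> t x tT; have := mC t x tT; have := mC' t x tT.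
  by rewrite !ler_norml /w; lra.
- by move=> x t; apply: cvgB; [exact: cm | exact: cm'].
- move=> t x tT; have D1 := Dm t x tT; have D2 := Dm' t x tT.
  have -> : J t x - (kappa + V x) * w t x = rhs (m t) x - rhs (m' t) x.
    by rewrite /J /w /rhs -!/(jump _ _); ring.
  exact: is_deriveB.
- move=> t x beta /subset_itv_oo_cc tT beta0 wbeta; rewrite /J ler_pM2l//.
  rewrite -lerBrDr; apply: (@rsum_jumpB_le _ _ _ _ _ _ _ _ C) => //.
  + by move=> z _; exact: mC.
  + by move=> z _; exact: mC'.
  + exact: mC.
  + exact: mC'.
  + by move=> z _; exact: wbeta.
Qed.

Theorem theorem3p1 (R : realType) (d : nat) (hd : (0 < d)%N)
  (kappa : R) (hkappa : 0 < kappa)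
  (a : 'rV[int]_d -> R)
  (a_ge0 : forall z : 'rV[int]_d, z != 0 -> 0 <= a z)
  (a_sym : forall z : 'rV[int]_d, z != 0 -> a z = a (- z))
  (a_sum : (\esum_(z in [set z : 'rV[int]_d | (z != 0)%R]) (a z)%:E)%E = 1%:E)
  (a_0 : a 0 = -1)
  (a_span : spans_lattice [set z | 0 < a z])
  (b : nat -> 'rV[int]_d -> R) (mu k : 'rV[int]_d -> R)
  (b_ge0 : forall n x, (2 <= n)%N -> 0 <= b n x)
  (mu_ge0 : forall x, 0 <= mu x)
  (b_bounded : forall n, (2 <= n)%N -> [bounded b n x | x in setT])
  (mu_bounded : [bounded mu x | x in setT])
  (k_bounded : [bounded k x | x in setT])
  (beta_cvg : forall x, cvgn (beta_partial b x))
  (delta1 delta2 : R) (hdelta1 : 0 < delta1) (hdelta2 : 0 < delta2)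
  (mu_beta : forall x, delta1 <= mu x - beta b x)
  (k_ge : forall x, delta2 <= k x)
  (u0 : 'rV[int]_d -> R)
  (u0_bounded : [bounded u0 x | x in setT])
  (m1 : R -> 'rV[int]_d -> R)
  (m1_bounded : forall T : R, 0 < T ->
    [bounded m1 p.1 p.2 | p in `[0, T] `*` [set: 'rV[int]_d]])
  (m1_init : forall x, m1 0 x = u0 x)
  (m1_eq : forall (t : R) x, 0 <= t ->
    is_derive_ge0 (fun s => m1 s x) t
      (kappa * rsum [set z : 'rV[int]_d | z != 0]
                 (fun z => a z * (m1 t (x + z) - m1 t x))
       + (beta b x - mu x) * m1 t x + k x)) :
  forall x : 'rV[int]_d, exists m1_infty : R, m1 t x @[t --> +oo] --> m1_infty.
Proof.
have mC (T : R) : 0 < T -> exists C : R, forall (t : R) x, t \in `[0, T]%R -> `|m1 t x| <= C.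
  move=> T0; have [C [_ HC]] := m1_bounded T T0.
  exists (C + 1) => t x tT; apply: (HC _ _ (t, x)); first by rewrite ltrDl.
  by split.
pose V x := mu x - beta b x.
pose rhs (u : 'rV[int]_d -> R) (x : 'rV[int]_d) : R :=
  kappa * rsum [set z | z != 0] (fun z => a z * (u (x + z) - u x))
  - V x * u x + k x.
have m1_eq' (t : R) x : 0 <= t -> is_derive_ge0 (m1^~ x) t (rhs (m1 t) x).
  by move=> t0; rewrite /rhs -mulNr /V opprB; exact: m1_eq.
have m1_der (t : R) x : 0 < t -> is_derive t (1 : R) (m1^~ x) (rhs (m1 t) x).
  by move=> t0; apply: is_derive_ge0_gt0 => //; exact: m1_eq' (ltW t0).
have m1_cont (T : R) x : 0 < T -> {within `[0, T], continuous (m1^~ x)}.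
  by move=> T0; apply: is_derive_ge0_within_continuous => // t; exact: m1_eq'.
(* For [h > 0] the time [s + h] is positive and two-sided derivatives suffice; [h = 0] needs the
   one-sided continuity at 0. *)
have shift_cont (h T : R) x : 0 <= h -> 0 < T ->
    {within `[0, T], continuous (fun s => m1 (s + h) x)}.
  rewrite le_eqVlt => /predU1P[<-|h0] T0.
    have -> : (fun s => m1 (s + 0) x) = m1^~ x.
      by apply/funext => s; rewrite addr0.
    exact: m1_cont.
  apply: derivable_within_continuous => t; rewrite in_itv/= => /andP[t0 _].
  have [] // := @is_derive_shiftr R (m1^~ x) t h _ (m1_der (t + h) x _).
  by rewrite ltr_wpDl.
(* [[0, 1]] contains both 0 and every admissible [h], so the initial increment is at most [K + K],
   uniformly in [h] and the site. *)
have [K HK] := mC 1 ltr01.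
have K0 : 0 <= K.
  apply: le_trans (normr_ge0 (m1 0 0)) (HK 0 0 _).
  by rewrite in_itv/= lexx ler01.
move=> x; apply: (@exp_increments_cvg R (m1^~ x) (K + K) delta1) => //.
move=> t h t0 /andP[h0 h1].
have T0 : 0 < t + 1 by rewrite ltr_wpDl.
(* The bound is taken on [[0, t + 2]] to cover times in [[0, t + 1]] shifted by [h <= 1]. *)
have [C HC] := mC _ (addr_gt0 T0 ltr01).
have shiftC (s : R) y : s \in `[0, t + 1]%R -> `|m1 (s + h) y| <= C.
  by rewrite in_itv/= => /andP[s0 st]; apply: HC; rewrite in_itv/=; lra.
have C' (s : R) y : s \in `[0, t + 1]%R -> `|m1 s y| <= C.
  by rewrite in_itv/= => /andP[s0 st]; apply: HC; rewrite in_itv/=; lra.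
have init y : `|m1 h y| <= K /\ `|m1 0 y| <= K.
  by split; apply: HK; rewrite in_itv/= ?lexx ?ler01 ?h0.
have tT : t \in `[0, t + 1]%R by rewrite in_itv/= t0; lra.
have shift_der (s : R) y : s \in `]0, t + 1[%R ->
    is_derive s (1 : R) (fun s => m1 (s + h) y) (rhs (m1 (s + h)) y).
  rewrite in_itv/= => /andP[s0 _]; apply: (@is_derive_shiftr R (m1^~ y)).
  by apply: m1_der; rewrite ltr_wpDr.
have der (s : R) y : s \in `]0, t + 1[%R ->
    is_derive s (1 : R) (m1^~ y) (rhs (m1 s) y).
  by rewrite in_itv/= => /andP[s0 _]; exact: m1_der.
have comp := @solution_comparison R _ [set z | z != 0] a V k kappa delta1
  (K + K) C (t + 1) _ _ a_ge0 a_sum (ltW hdelta1) (addr_ge0 K0 K0) hkappa T0 mu_beta.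
(* The two signs come from exchanging the roles of the solution and its time shift. *)
rewrite ler_norml; apply/andP; split.
  rewrite lerNl opprB.
  apply: (comp m1 (fun s => m1 (s + h))) => // y.
  - exact: m1_cont.
  - exact: shift_cont.
  - by rewrite add0r; have [] := init y; rewrite !ler_norml; lra.
apply: (comp (fun s => m1 (s + h)) m1) => // y.
- exact: shift_cont.
- exact: m1_cont.
- by rewrite add0r; have [] := init y; rewrite !ler_norml; lra.
Qed.
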